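(* For any strongly zero-dimensional frame $L$, the following are equivalent. (1) $L$ is basically disconnected (BD). (2) $L$ is $CL$-basic (that is, $CL$ is a $\sigma$-frame). (3) $CL=D_\sigma CL=\mathfrak{B}(\mathrm{Coz}\,L)$. (4) $CL$ is a $\sigma$-complete Boolean algebra. (5) The embedding of $CL$ into $\mathrm{Coz}\,L$ has a left adjoint. (6) $\lambda L$ is BD. (7) $\beta L$ is BD.
   Context: For a frame $L$, $a^*$ denotes the pseudocomplement of $a$ and $CL$ the Boolean algebra of complemented elements. $x\prec\!\!\prec y$ (completely below) means there are $c_q$ ($q\in\mathbb{Q}\cap[0,1]$) with $c_0=x$, $c_1=y$, and $c_p^*\vee c_q=1$ for $p<q$. For completely regular $L$, $\mathrm{Coz}\,L$ is the $\sigma$-frame of cozero elements, i.e. elements of the form $\bigvee\{a_n:n\in\mathbb{N}\}$ with $a_n\prec\!\!\prec a_{n+1}$ for all $n$. $L$ is zero-dimensional if every element is a join of elements of $CL$ (such frames are completely regular), and strongly zero-dimensional if moreover every cozero element is a countable join of complemented elements. A $\sigma$-frame is a bounded lattice with countable joins in which binary meets distribute over countable joins. ''$CL$ is a $\sigma$-frame'' refers to $CL$ in its own order. For $S\subseteq L$, $\mathfrak{B}S=\{s^{**}:s\in S\}$. A (completely regular) frame $L$ is basically disconnected (BD) if $a^*\vee a^{**}=1$ for all $a\in\mathrm{Coz}\,L$, equivalently $\mathfrak{B}(\mathrm{Coz}\,L)=CL$. For a meet-semilattice $A$, a subset $G\subseteq A$ is admissible if $\bigvee G$ exists in $A$ and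 for each $a\in A$ the join $\bigvee\{a\wedge y:y\in G\}$ exists in $A$ and equals $a\wedge\bigvee G$; a downset $E$ of $A$ is a D-ideal if $\bigvee G\in E$ for each admissible $G\subseteq E$; $D_\infty A$ is the frame of D-ideals under inclusion. When $A$ is a base of $L$ closed under binary meets, $D_\infty A$ is identified with the sublocale $\{x\in L:\{a\in A:a\le x\}\text{ is a D-ideal of }A\}$ of $L$ (which contains $A$). $D_\sigma CL$ is the sub-$\sigma$-frame of $D_\infty CL$ generated by $CL$. $\lambda L$, the Lindelöf (regular) coreflection of $L$, is the frame of $\sigma$-ideals of $\mathrm{Coz}\,L$ (downsets closed under countable joins). $\beta L$, the compact regular coreflection of $L$, is the frame of ideals $I$ of $L$ such that each $x\in I$ satisfies $x\prec\!\!\prec y$ for some $y\in I$. *)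

(* Defs.v *)
From HB Require Import structures.
From mathcomp Require Import all_boot all_order all_algebra.
From mathcomp Require Import boolp classical_sets functions cardinality.

Set Implicit Arguments.
Unset Strict Implicit.
Unset Printing Implicit Defensive.

Import Order.TTheory.
Local Open Scope classical_set_scope.
Local Open Scope order_scope.

(* The joins are those of [T] itself: for a subset of a frame they may differ
   from the joins of the ambient frame. *)
Definition is_sigma_frame d (T : tbLatticeType d) : Prop :=
  (forall U : set T, countable U -> exists s, isLub U s) /\
  (forall (U : set T) (s a : T), countable U -> isLub U s ->
     isLub [set a `&` x | x in U] (a `&` s)).

Definition sigma_complete_boolean_algebra d (B : ctbDistrLatticeType d) :
    Prop :=
  forall U : set B, countable U -> exists s, isLub U s.

Definition has_left_adjoint d d' (P : porderType d) (Q : porderType d')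
    (f : P -> Q) : Prop :=
  exists g : Q -> P, forall (q : Q) (p : P), (g q <= p) = (q <= f p).

Definition downset d (P : porderType d) (E : set P) : Prop :=
  forall x y : P, x <= y -> E y -> E x.

HB.mixin Record TBDistrLattice_isFrame d T of Order.TBDistrLattice d T := {
  Sup : set T -> T;
  Sup_ub : forall (S : set T) x, S x -> (x <= Sup S)%O;
  Sup_le : forall (S : set T) y, (forall x, S x -> (x <= y)%O) ->
    (Sup S <= y)%O;
  meet_Sup : forall (a : T) (S : set T),
    Order.meet a (Sup S) = Sup [set Order.meet a x | x in S]
}.

#[short(type="frameType")]
HB.structure Definition Frame d :=
  { T of TBDistrLattice_isFrame d T & Order.TBDistrLattice d T }.

HB.factory Record POrder_isFrame d T of Order.POrder d T := {
  meet : T -> T -> T;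
  Sup : set T -> T;
  lexI : forall x y z : T, (x <= meet y z)%O = (x <= y)%O && (x <= z)%O;
  Sup_ub : forall (S : set T) x, S x -> (x <= Sup S)%O;
  Sup_le : forall (S : set T) y, (forall x, S x -> (x <= y)%O) ->
    (Sup S <= y)%O;
  meet_Sup_le : forall (a : T) (S : set T),
    (meet a (Sup S) <= Sup [set meet a x | x in S])%O
}.

HB.builders Context d T of POrder_isFrame d T.

Let join (x y : T) := Sup [set z | z = x \/ z = y].

Fact leUx (x y z : T) : (join x y <= z) = (x <= z) && (y <= z).
Proof.
apply/idP/andP => [h|[xz yz]]; last by apply: Sup_le => t /= [] ->.
by split; apply: le_trans h; apply: Sup_ub; [left|right].
Qed.

HB.instance Definition _ := @Order.POrder_isMeetSemilattice.Build d T meet lexI.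
HB.instance Definition _ := @Order.POrder_isJoinSemilattice.Build d T join leUx.

Fact bot_le (x : T) : Sup set0 <= x.
Proof. exact: Sup_le. Qed.
Fact le_top (x : T) : x <= Sup setT.
Proof. exact: Sup_ub. Qed.

HB.instance Definition _ := @Order.hasBottom.Build d T (Sup set0) bot_le.
HB.instance Definition _ := @Order.hasTop.Build d T (Sup setT) le_top.

Fact meetUl : @left_distributive T T Order.meet Order.join.
Proof.
move=> x y z; apply/le_anti/andP; split; last first.
  by rewrite leUx; apply/andP; split; apply: leI2; rewrite ?leUl ?leUr.
rewrite meetC; apply: (le_trans (meet_Sup_le _ _)).
by apply: Sup_le => _ [t [->|->] <-];
  rewrite [X in X <= _](meetC z) ?leUl ?leUr.
Qed.

HB.instance Definition _ := Order.Lattice_Meet_isDistrLattice.Build d T meetUl.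

Fact meet_Sup (a : T) (S : set T) :
  Order.meet a (Sup S) = Sup [set Order.meet a x | x in S].
Proof.
apply/le_anti/andP; split; first exact: meet_Sup_le.
apply: Sup_le => _ [x Sx <-]; apply: leI2 => //; exact: Sup_ub.
Qed.

HB.instance Definition _ :=
  @TBDistrLattice_isFrame.Build d T Sup Sup_ub Sup_le meet_Sup.

HB.end.

Section FrameNotions.
Context {d : Order.disp_t} {L : frameType d}.
Implicit Types (a x y : L) (S U : set L).

Definition pcompl a : L := Sup [set x | x `&` a = \bot].

Definition CL : set L :=
  [set a | exists b : L, a `&` b = \bot /\ a `|` b = \top].

(* Only the values of [c] on the rationals of [0, 1] matter. *)
Definition completely_below x y : Prop :=
  exists c : rat -> L, [/\ c 0%R = x, c 1%R = y &
    forall p q : rat, (0 <= p)%R -> (p < q)%R -> (q <= 1)%R ->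
      pcompl (c p) `|` c q = \top].

Definition Coz : set L := [set a | exists u : nat -> L,
  (forall n, completely_below (u n) (u n.+1)) /\ a = Sup (range u)].

(* The nullary join is the case [U = set0]; hence [\bot] belongs to [S]. *)
Definition sub_sigma_frame S : Prop :=
  [/\ S \top,
      forall x y, S x -> S y -> S (x `&` y) &
      forall U, countable U -> U `<=` S -> S (Sup U)].

End FrameNotions.

Arguments CL {d} L.
Arguments Coz {d} L.

Notation "x ≺≺ y" := (completely_below x y) (at level 70).

Section FrameTheory.
Context {d : Order.disp_t} {L : frameType d}.
Implicit Types (a b x y z : L) (S U : set L).

Lemma pcompl_meet a : a `&` pcompl a = \bot.
Proof.
rewrite /pcompl meet_Sup; apply/le_anti/andP; split; last exact: le0x.
by apply: Sup_le => _ [x /= xa <-]; rewrite meetC xa.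
Qed.

Lemma le_pcompl x a : (x <= pcompl a) = (x `&` a == \bot).
Proof.
apply/idP/eqP => [xa|xa]; last exact: Sup_ub.
apply/le_anti/andP; split; last exact: le0x.
by rewrite -(pcompl_meet a) [leRHS]meetC; apply: leI2.
Qed.

Lemma pcompl_anti x y : x <= y -> pcompl y <= pcompl x.
Proof.
move=> xy; rewrite le_pcompl -lex0 -(pcompl_meet y) [leRHS]meetC.
exact: leI2.
Qed.

Lemma pcomplU x y : pcompl (x `|` y) = pcompl x `&` pcompl y.
Proof.
apply/le_anti/andP; split.
  by rewrite lexI !pcompl_anti ?leUl ?leUr.
rewrite le_pcompl meetUr -meetA [pcompl y `&` x]meetC meetA.
rewrite -[X in _ `|` X]meetA [pcompl y `&` y]meetC pcompl_meet meetx0 joinx0.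
by rewrite [pcompl x `&` x]meetC pcompl_meet meet0x.
Qed.

Lemma completely_below_le x y : x ≺≺ y -> x <= y.
Proof.
case=> c [<- <- cP]; rewrite leEmeet; apply/eqP.
rewrite -[RHS]meetx1 -(cP 0%R 1%R) // meetUr pcompl_meet join0x.
by [].
Qed.

Lemma completely_belowW x' x y y' : x' <= x -> x ≺≺ y -> y <= y' -> x' ≺≺ y'.
Proof.
move=> xx [c [c0 c1 cP]] yy.
exists (fun q => if (q == 0)%R then x' else if (q == 1)%R then y' else c q).
split=> // p q p0 pq q1.
have q0 : (q == 0)%R = false by rewrite gt_eqF // (Order.POrderTheory.le_lt_trans p0).
have p1 : (p == 1)%R = false by rewrite lt_eqF // (Order.POrderTheory.lt_le_trans pq).
rewrite q0 p1.
apply/le_anti; rewrite lex1 /= -(cP p q p0 pq q1); apply: leU2.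
  by case: eqP => [->|//]; apply: pcompl_anti; rewrite c0.
by case: eqP => [->|//]; rewrite c1.
Qed.

Lemma completely_belowU x y x' y' :
  x ≺≺ y -> x' ≺≺ y' -> (x `|` x') ≺≺ (y `|` y').
Proof.
move=> [c [c0 c1 cP]] [e [e0 e1 eP]].
exists (fun q => c q `|` e q); rewrite c0 c1 e0 e1; split=> // p q p0 pq q1.
rewrite pcomplU joinIl joinA cP // join1x meet1x.
by rewrite [c q `|` _]joinC joinA eP // join1x.
Qed.

Lemma completely_belowI x y x' y' :
  x ≺≺ y -> x' ≺≺ y' -> (x `&` x') ≺≺ (y `&` y').
Proof.
move=> [c [c0 c1 cP]] [e [e0 e1 eP]].
exists (fun q => c q `&` e q); rewrite c0 c1 e0 e1; split=> // p q p0 pq q1.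
apply/le_anti; rewrite lex1 /= joinIr lexI; apply/andP; split.
  rewrite -(cP p q p0 pq q1); apply: leU2 => //.
  by apply: pcompl_anti; exact: leIl.
rewrite -(eP p q p0 pq q1); apply: leU2 => //.
by apply: pcompl_anti; exact: leIr.
Qed.

Lemma CL_completely_below a : CL L a -> a ≺≺ a.
Proof.
move=> [b [ab0 ab1]]; exists (fun=> a); split=> // p q _ _ _.
apply/le_anti; rewrite lex1 /= -ab1 joinC; apply: leU2 => //.
by rewrite le_pcompl meetC ab0.
Qed.

Lemma CL_subset_Coz : CL L `<=` Coz L.
Proof.
move=> a aC; exists (fun=> a); split=> [n|]; first exact: CL_completely_below.
apply/le_anti/andP; split; first by apply: Sup_ub; exists 0.
by apply: Sup_le => _ [n _ <-].
Qed.

Lemma CL0 : CL L \bot.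
Proof. by exists \top; rewrite meet0x join0x. Qed.

Lemma CL1 : CL L \top.
Proof. by exists \bot; rewrite meetx0 joinx0. Qed.

Lemma CLI a b : CL L a -> CL L b -> CL L (a `&` b).
Proof.
move=> [a' [a0 a1]] [b' [b0 b1]]; exists (a' `|` b'); split.
  rewrite meetUr meetAC a0 meet0x join0x.
  by rewrite -meetA b0 meetx0.
by rewrite joinIl joinA a1 join1x meet1x joinCA b1 joinx1.
Qed.

Lemma CLU a b : CL L a -> CL L b -> CL L (a `|` b).
Proof.
move=> [a' [a0 a1]] [b' [b0 b1]]; exists (a' `&` b'); split.
  rewrite meetUl meetA a0 meet0x join0x.
  by rewrite meetCA b0 meetx0.
by rewrite joinIr joinAC a1 join1x meet1x -joinA b1 joinx1.
Qed.

Lemma CozI a b : Coz L a -> Coz L b -> Coz L (a `&` b).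
Proof.
move=> [u [uP ->]] [v [vP ->]]; exists (fun n => u n `&` v n); split.
  by move=> n; exact: completely_belowI.
have um := homo_leq (@lexx _ L) (@le_trans _ L)
  (fun n => completely_below_le (uP n)).
have vm := homo_leq (@lexx _ L) (@le_trans _ L)
  (fun n => completely_below_le (vP n)).
apply/le_anti/andP; split; last first.
  by apply: Sup_le => _ [n _ <-]; apply: leI2; apply: Sup_ub; exists n.
rewrite meet_Sup; apply: Sup_le => _ [_ [m _ <-] <-].
rewrite meetC meet_Sup; apply: Sup_le => _ [_ [n _ <-] <-].
apply: (@le_trans _ _ (u (maxn m n) `&` v (maxn m n))).
  rewrite [leRHS]meetC.
  by apply: leI2; [apply: vm; exact: leq_maxl|apply: um; exact: leq_maxr].
by apply: Sup_ub; exists (maxn m n).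
Qed.

Lemma Coz_Sup_seq (F : nat -> L) : (forall n, Coz L (F n)) ->
  Coz L (Sup (range F)).
Proof.
move=> /choice[u uP].
pose v n := \join_(i < n.+1) u i n.
have um i := homo_leq (@lexx _ L) (@le_trans _ L)
  (fun n => completely_below_le ((uP i).1 n)).
exists v; split=> [n|].
  rewrite /v [X in _ ≺≺ X]big_ord_recr /=.
  apply: (@completely_belowW _ (\join_(i < n.+1) u i n) (\join_(i < n.+1) u i n.+1));
    [exact: lexx| |exact: leUl].
  elim/big_ind2: _ => [|????|i _].
  - by apply: CL_completely_below; exact: CL0.
  - exact: completely_belowU.
  - exact: (uP i).1.
apply/le_anti/andP; split.
  apply: Sup_le => _ [i _ <-]; rewrite (uP i).2.
  apply: Sup_le => _ [n _ <-].
  apply: (@le_trans _ _ (v (maxn i n))); last by apply: Sup_ub; exists (maxn i n).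
  have im : (i < (maxn i n).+1)%N by rewrite ltnS leq_maxl.
  apply: (@le_trans _ _ (u i (maxn i n))); first by apply: um; exact: leq_maxr.
  exact: (joins_sup (j := Ordinal im) (P := xpredT) (fun i0 => u i0 (maxn i n))).
apply: Sup_le => _ [n _ <-]; apply/joinsP => i _.
apply: (@le_trans _ _ (F i)); last by apply: Sup_ub; exists (i : nat).
by rewrite (uP i).2; apply: Sup_ub; exists n.
Qed.

Lemma Coz_Sup U : countable U -> U `<=` Coz L -> Coz L (Sup U).
Proof.
move=> /countable_injP[f finj] UC.
pose F n := Sup [set x | U x /\ f x = n].
have FU x : U x -> F (f x) = x.
  move=> Ux; apply/le_anti/andP; split; last exact: Sup_ub.
  apply: Sup_le => y [Uy /finj yx]; rewrite yx ?inE //.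
have -> : Sup U = Sup (range F).
  apply/le_anti/andP; split; apply: Sup_le => x.
    by move=> Ux; apply: Sup_ub; exists (f x); rewrite ?FU.
  by move=> [n _ <-]; apply: Sup_le => y [Uy _]; exact: Sup_ub.
apply: Coz_Sup_seq => n.
have [[x [Ux <-]]|noU] := pselect (exists x, U x /\ f x = n).
  by rewrite FU //; exact: UC.
suff -> : F n = \bot by apply: CL_subset_Coz; exact: CL0.
apply/le_anti; rewrite le0x andbT; apply: Sup_le => y yP.
by case: noU; exists y.
Qed.

End FrameTheory.

Definition CLtype d (L : frameType d) : Type := {a : L | a \in CL L}.
Definition Coztype d (L : frameType d) : Type := {a : L | a \in Coz L}.

Section SubLattices.
Context {d : Order.disp_t} {L : frameType d}.

HB.instance Definition _ := SubChoice.on (CLtype L).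
HB.instance Definition _ := SubChoice.on (Coztype L).

Fact CL_opredI : {in [pred a | a \in CL L] &, forall a b, a `&` b \in CL L}.
Proof. by move=> a b; rewrite !inE; exact: CLI. Qed.
Fact CL_opredU : {in [pred a | a \in CL L] &, forall a b, a `|` b \in CL L}.
Proof. by move=> a b; rewrite !inE; exact: CLU. Qed.
Fact CL_opred0 : \bot \in CL L.
Proof. by rewrite inE; exact: CL0. Qed.
Fact CL_opred1 : \top \in CL L.
Proof. by rewrite inE; exact: CL1. Qed.

HB.instance Definition _ := Order.SubChoice_isTBSubLattice.Build d L
  (fun a => a \in CL L) d (CLtype L) CL_opredI CL_opredU CL_opred0 CL_opred1.

Fact Coz_opredI : {in [pred a | a \in Coz L] &, forall a b, a `&` b \in Coz L}.
Proof. by move=> a b; rewrite !inE; exact: CozI. Qed.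
Fact Coz_opredU : {in [pred a | a \in Coz L] &, forall a b, a `|` b \in Coz L}.
Proof.
move=> a b; rewrite !inE => aC bC.
have -> : a `|` b = Sup (a |` [set b]).
  apply/le_anti/andP; split.
    by rewrite leUx !Sup_ub //; [right|left].
  by apply: Sup_le => x [->|->]; [exact: leUl|exact: leUr].
apply: Coz_Sup => [|x [->|->]] //.
by apply: finite_set_countable; exact: finite_set2.
Qed.
Fact Coz_opred0 : \bot \in Coz L.
Proof. by rewrite inE; exact/CL_subset_Coz/CL0. Qed.
Fact Coz_opred1 : \top \in Coz L.
Proof. by rewrite inE; exact/CL_subset_Coz/CL1. Qed.

HB.instance Definition _ := Order.SubChoice_isTBSubLattice.Build d L
  (fun a => a \in Coz L) d (Coztype L)
  Coz_opredI Coz_opredU Coz_opred0 Coz_opred1.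

Lemma CL_valI (a b : CLtype L) : val (a `&` b) = val a `&` val b.
Proof. by []. Qed.
Lemma CL_valU (a b : CLtype L) : val (a `|` b) = val a `|` val b.
Proof. by []. Qed.
Lemma CL_val0 : val (\bot : CLtype L) = \bot.
Proof. by []. Qed.
Lemma CL_val1 : val (\top : CLtype L) = \top.
Proof. by []. Qed.
Lemma CL_val_le (a b : CLtype L) : (val a <= val b) = (a <= b).
Proof. by []. Qed.
Lemma Coz_val_le (a b : Coztype L) : (val a <= val b) = (a <= b).
Proof. by []. Qed.
Lemma Coz_valI (a b : Coztype L) : val (a `&` b) = val a `&` val b.
Proof. by []. Qed.
Lemma Coz_valU (a b : Coztype L) : val (a `|` b) = val a `|` val b.
Proof. by []. Qed.

Fact CL_meetUl : @left_distributive (CLtype L) (CLtype L) Order.meet Order.join.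
Proof. by move=> x y z; apply: val_inj; rewrite !(CL_valI, CL_valU) meetUl. Qed.

HB.instance Definition _ :=
  Order.Lattice_Meet_isDistrLattice.Build d (CLtype L) CL_meetUl.

Fact CL_pcompl a : CL L a -> a `|` pcompl a = \top.
Proof.
move=> /CL_completely_below[c [c0 c1 cP]].
by rewrite joinC -[X in pcompl X]c0 -c1; apply: cP.
Qed.

Fact CL_pcompl_mem (a : CLtype L) : pcompl (val a) \in CL L.
Proof.
have := valP a; rewrite !inE => aC; exists (val a).
by rewrite meetC joinC pcompl_meet CL_pcompl.
Qed.

Let CLcompl (a : CLtype L) : CLtype L := Sub (pcompl (val a)) (CL_pcompl_mem a).

Fact CL_joinxC (a : CLtype L) : a `|` CLcompl a = \top.
Proof.
apply: val_inj; rewrite CL_valU SubK CL_pcompl //.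
by have := valP a; rewrite inE.
Qed.

Fact CL_meetxC (a : CLtype L) : a `&` CLcompl a = \bot.
Proof. by apply: val_inj; rewrite CL_valI SubK pcompl_meet. Qed.

HB.instance Definition _ := Order.TBDistrLattice_hasComplement.Build d
  (CLtype L) CL_joinxC CL_meetxC.

Fact CL_in_Coz (a : CLtype L) : val a \in Coz L.
Proof. by have := valP a; rewrite !inE; exact: CL_subset_Coz. Qed.

Definition CL_to_Coz (a : CLtype L) : Coztype L := Sub (val a) (CL_in_Coz a).

Lemma Coz_isLub (U : set (Coztype L)) s : countable U ->
  isLub U s <-> val s = Sup [set val x | x in U].
Proof.
move=> Uc.
have SC : Sup [set val x | x in U] \in Coz L.
  rewrite inE; apply: Coz_Sup; first exact: sub_countable (card_image_le _ _) _.
  by move=> _ [x _ <-]; have := valP x; rewrite inE.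
split=> [[sU sl]|sE]; last first.
  split=> [x Ux|b bU]; rewrite -Coz_val_le sE; first by apply: Sup_ub; exists x.
  by apply: Sup_le => _ [x Ux <-]; rewrite Coz_val_le; exact: bU.
apply/le_anti/andP; split.
  rewrite -[leRHS](SubK (Coztype L) SC) Coz_val_le; apply: sl => x Ux.
  by rewrite -Coz_val_le SubK; apply: Sup_ub; exists x.
by apply: Sup_le => _ [x Ux <-]; rewrite Coz_val_le; exact: sU.
Qed.

Lemma Coz_sigma_frame : is_sigma_frame (Coztype L).
Proof.
split=> [U Uc|U s a Uc].
  have SC : Sup [set val x | x in U] \in Coz L.
    rewrite inE; apply: Coz_Sup.
      exact: sub_countable (card_image_le _ _) _.
    by move=> _ [x _ <-]; have := valP x; rewrite inE.
  by exists (Sub (Sup _) SC); apply/Coz_isLub.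
move=> /(Coz_isLub _ Uc) sE; apply/Coz_isLub.
  exact: sub_countable (card_image_le _ _) _.
by rewrite Coz_valI sE meet_Sup !image_comp; congr Sup.
Qed.

End SubLattices.

(* A set [C] of downsets, ordered by inclusion, is a frame in which the join of
   [F] is the member of [C'] generated by the union of [F]. For regular ideals
   [C'] is the set of all ideals; in the other cases [C' = C]. *)
Record ideal_system d (P : meetSemilatticeType d) (C' C : set (set P)) : Prop :=
{ sys_down : forall I, C I -> downset I;
  sys_sub : C `<=` C';
  sys_meet : forall I J, C I -> C J -> C (I `&` J)%classic;
  sys_imp : forall I K, C I -> C K -> C' [set x | forall y, I y -> K (x `&` y)];
  sys_sup : forall F, F `<=` C -> C (smallest C' (\bigcup_(I in F) I)) }.

Definition ideal_frame d (P : meetSemilatticeType d) (C' C : set (set P))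
  (_ : ideal_system C' C) : Type := {I : set P | I \in C}.

Section IdealFrame.
Context {d : Order.disp_t} {P : meetSemilatticeType d} {C' C : set (set P)}.
Variable sysC : ideal_system C' C.
Local Notation T := (ideal_frame sysC).

HB.instance Definition _ := SubChoice.on T.
HB.instance Definition _ := Order.SubChoice_isSubPOrder.Build set_display
  (set P) (fun I => I \in C) set_display T.

Lemma ideal_frame_le (I J : T) : (I <= J) = (val I `<=` val J) :> Prop.
Proof. exact: subsetEset. Qed.

Let inC (I : T) : C (val I). Proof. by have := valP I; rewrite inE. Qed.

Fact ideal_meet_mem (I J : T) : (val I `&` val J)%classic \in C.
Proof. by rewrite inE; apply: (sys_meet sysC). Qed.

Fact ideal_Sup_mem (F : set T) :
  smallest C' (\bigcup_(I in [set val J | J in F]) I) \in C.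
Proof. by rewrite inE; apply: (sys_sup sysC) => _ [J _ <-]. Qed.

Let meetT (I J : T) : T := Sub (val I `&` val J)%classic (ideal_meet_mem I J).
Let SupT (F : set T) : T := Sub (smallest _ _) (ideal_Sup_mem F).

Fact ideal_lexI (I J K : T) : (I <= meetT J K) = (I <= J) && (I <= K).
Proof.
apply/idP/andP; rewrite !ideal_frame_le SubK; first by rewrite subsetI.
by move=> [IJ IK]; rewrite subsetI.
Qed.

Fact ideal_Sup_ub (F : set T) I : F I -> I <= SupT F.
Proof.
move=> FI; rewrite ideal_frame_le SubK; apply: sub_smallest => x Ix.
by exists (val I) => //; exists I.
Qed.

Fact ideal_Sup_le (F : set T) K : (forall I, F I -> I <= K) -> SupT F <= K.
Proof.
move=> FK; rewrite ideal_frame_le SubK; apply: smallest_sub.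
  exact: (sys_sub sysC).
by move=> x [_ [I FI <-] Ix]; have := FK _ FI; rewrite ideal_frame_le; apply.
Qed.

Fact ideal_meet_Sup_le (I : T) (F : set T) :
  meetT I (SupT F) <= SupT [set meetT I J | J in F].
Proof.
set K := (X in _ <= X); rewrite ideal_frame_le [val (meetT _ _)]SubK => x [Ix Fx].
suff : [set x | forall y, val I y -> val K (x `&` y)] x.
  by move=> /(_ x Ix); rewrite meetxx.
move: x Fx {Ix}; rewrite SubK; apply: smallest_sub; first exact: (sys_imp sysC).
move=> z [_ [J FJ <-] Jz] y Iy.
have := @ideal_Sup_ub [set meetT I J | J in F] (meetT I J).
rewrite ideal_frame_le [val (meetT _ _)]SubK; apply; first by exists J.
split; first by apply: (sys_down sysC (inC I)) Iy; exact: leIr.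
by apply: (sys_down sysC (inC J)) Jz; exact: leIl.
Qed.

HB.instance Definition _ := @POrder_isFrame.Build set_display T
  meetT SupT ideal_lexI ideal_Sup_ub ideal_Sup_le ideal_meet_Sup_le.

End IdealFrame.

Lemma ideal_system_closure d (P : meetSemilatticeType d) (C : set (set P)) :
  (forall I, C I -> downset I) ->
  (forall F, F `<=` C -> C (\bigcap_(I in F) I)) ->
  (forall I K, C I -> C K -> C [set x | forall y, I y -> K (x `&` y)]) ->
  ideal_system C C.
Proof.
move=> down cap imp; split=> // [I J CI CJ|F FC]; last first.
  by apply: cap => I [].
rewrite (_ : (I `&` J)%classic = \bigcap_(K in [set I; J]) K).
  by apply: cap => K [->|->].
by apply/seteqP; split=> x /= => [[Ix Jx] K [->|->]|h] //; split; apply: h; [left|right].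
Qed.

(* [U] may be empty or finite: [countable] means at most countable. *)
Definition sigma_ideal d (P : porderType d) : set (set P) :=
  [set I | downset I /\ forall (U : set P) (s : P),
    countable U -> U `<=` I -> isLub U s -> I s].
Arguments sigma_ideal {d} P.

Lemma sigma_ideal_system d (T : tbLatticeType d) :
  is_sigma_frame T -> ideal_system (sigma_ideal T) (sigma_ideal T).
Proof.
move=> [_ dT]; apply: ideal_system_closure => [I []//|F FC|I K [dI _] [dK cK]].
  split=> [x y xy yF I FI|U s Uc UF sU I FI].
    by apply: (FC I FI).1 xy _; exact: yF.
  by apply: (FC I FI).2 sU => // x Ux; exact: UF.
split=> [x y xy yP z Iz|U s Uc UP sU z Iz].
  by apply: dK (yP z Iz); exact: leI2.
rewrite meetC; apply: cK (dT U s z Uc sU); first exact: sub_countable (card_image_le _ _) _.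
by move=> _ [x Ux <-]; rewrite meetC; exact: UP.
Qed.

(* The Lindelöf coreflection of [L]. *)
Definition lambda d (L : frameType d) : frameType set_display :=
  ideal_frame (sigma_ideal_system (@Coz_sigma_frame d L)).

Definition lattice_ideal d (P : latticeType d) : set (set P) :=
  [set I | [/\ I !=set0, downset I & forall x y, I x -> I y -> I (x `|` y)]].
Arguments lattice_ideal {d} P.

Definition regular_ideal d (L : frameType d) : set (set L) :=
  [set I | lattice_ideal L I /\ forall x, I x -> exists2 y, I y & x ≺≺ y].
Arguments regular_ideal {d} L.

Lemma lattice_ideal_smallest d (P : bLatticeType d) (U : set P) :
  lattice_ideal P (smallest (lattice_ideal P) U).
Proof.
split.
- exists \bot => I [[[x Ix] dI _] _]; apply: dI Ix; exact: le0x.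
- move=> x y xy yP I CI; have := yP I CI; case: CI => [[_ dI _] _]; exact: dI.
- move=> x y xP yP I CI; have := xP I CI; have := yP I CI.
  by case: CI => [[_ _ jI] _] *; exact: jI.
Qed.

Lemma regular_ideal_system d (L : frameType d) :
  ideal_system (lattice_ideal L) (regular_ideal L).
Proof.
have bI (I : set L) : lattice_ideal L I -> I \bot.
  by move=> [[x Ix] dI _]; apply: dI Ix; exact: le0x.
split=> [I [[]]//|I []//|I J [iI rI] [iJ rJ]|I K [[I0 dI jI] _] [iK _]|F FC].
- split; first split.
  + by exists \bot; split; exact: bI.
  + by move=> x y xy [Iy Jy]; split; [case: iI|case: iJ] => _ h _; exact: h xy _.
  + by move=> x y [Ix Jx] [Iy Jy]; split; [case: iI|case: iJ] => _ _; exact.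
  move=> x [/rI[y Iy xy] /rJ[z Jz xz]]; exists (y `&` z).
    split; [case: iI|case: iJ] => _ h _; first exact: h (leIl _ _) Iy.
    exact: h (leIr _ _) Jz.
  by rewrite -[x]meetxx; exact: completely_belowI.
- have [_ dK jK] := iK; split.
  + by exists \bot => y _; rewrite meet0x; exact: bI.
  + by move=> x y xy yP z Iz; apply: dK (yP z Iz); exact: leI2.
  + by move=> x y xP yP z Iz; rewrite meetUl; apply: jK; [exact: xP|exact: yP].
split; first exact: lattice_ideal_smallest.
set G := smallest _ _.
have iG : lattice_ideal L G by exact: lattice_ideal_smallest.
have [_ dG jG] := iG.
suff : G `<=` [set x | exists2 y, G y & x ≺≺ y] by [].
apply: smallest_sub.
  split.
  - by exists \bot, \bot; [exact: bI|exact/CL_completely_below/CL0].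
  - by move=> x y xy [z Gz yz]; exists z => //; exact: completely_belowW xy yz _.
  - move=> x y [x' Gx xx'] [y' Gy yy']; exists (x' `|` y'); first exact: jG.
    exact: completely_belowU.
move=> x [I FI Ix]; have [_ /(_ x Ix)[y Iy xy]] := FC I FI; exists y => //.
by apply: sub_gen_smallest; exists I.
Qed.

(* The compact regular coreflection of [L]. *)
Definition beta d (L : frameType d) : frameType set_display :=
  ideal_frame (regular_ideal_system L).

Definition admissible d (A : meetSemilatticeType d) (G : set A) : Prop :=
  exists g, isLub G g /\ forall a, isLub [set a `&` y | y in G] (a `&` g).

Definition D_ideal d (A : meetSemilatticeType d) : set (set A) :=
  [set E | downset E /\ forall (G : set A) (g : A),
    admissible G -> G `<=` E -> isLub G g -> E g].
Arguments D_ideal {d} A.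

Lemma isLub_uniq d (P : porderType d) (U : set P) x y :
  isLub U x -> isLub U y -> x = y.
Proof.
by move=> [Ux xl] [Uy yl]; apply/le_anti/andP; split; [exact: xl|exact: yl].
Qed.

Lemma D_ideal_system d (A : meetSemilatticeType d) :
  ideal_system (D_ideal A) (D_ideal A).
Proof.
apply: ideal_system_closure => [E []//|F FC|I K [dI _] [dK cK]].
  split=> [x y xy yF I FI|G g aG GF gG I FI].
    by apply: (FC I FI).1 xy _; exact: yF.
  by apply: (FC I FI).2 gG => // x Gx; exact: GF.
split=> [x y xy yP z Iz|G g [g' [g'G dG]] GP gG z Iz].
  by apply: dK (yP z Iz); exact: leI2.
have {g' g'G} dG a : isLub [set a `&` y | y in G] (a `&` g).
  by rewrite (isLub_uniq gG g'G).
rewrite meetC; apply: cK (dG z).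
  exists (z `&` g); split=> // a; rewrite image_comp meetA.
  rewrite (eq_imagel (f' := fun y => (a `&` z) `&` y)) //.
  by move=> y _ /=; rewrite meetA.
by move=> _ [x Gx <-]; rewrite meetC; exact: GP.
Qed.

Definition D_infty d (A : meetSemilatticeType d) : frameType set_display :=
  ideal_frame (D_ideal_system A).

Section DSigma.
Context {d : Order.disp_t}.
Variable L : frameType d.

(* The complemented [a], as an element of [D_infty (CLtype L)], is its principal
   downset, which is [CL_below (val a)]. *)
Definition CL_below (x : L) : set (CLtype L) := [set a | val a <= x].

Definition D_sigma : set (D_infty (CLtype L)) :=
  smallest sub_sigma_frame [set E : D_infty (CLtype L) |
    exists a : CLtype L, val E = CL_below (val a)].

(* When [CL L] is a base of [L], mapping [x] to [CL_below x] identifies the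
   sublocale of those [x] for which [CL_below x] is a D-ideal with
   [D_infty (CLtype L)]; this is [D_sigma] seen in [L]. *)
Definition D_sigma_CL : set L :=
  [set x | exists2 E, D_sigma E & val E = CL_below x].

End DSigma.

Arguments D_sigma {d} L.
Arguments D_sigma_CL {d} L.

Section FrameProperties.
Context {d : Order.disp_t}.
Variable L : frameType d.

Definition zero_dimensional : Prop :=
  forall x : L, exists2 S : set L, S `<=` CL L & x = Sup S.

Definition strongly_zero_dimensional : Prop :=
  zero_dimensional /\ forall a : L, Coz L a ->
    exists S : set L, [/\ countable S, S `<=` CL L & a = Sup S].

Definition basically_disconnected : Prop :=
  forall a : L, Coz L a -> pcompl a `|` pcompl (pcompl a) = \top.

Definition CL_basic : Prop := is_sigma_frame (CLtype L).

Definition skeleton_image (S : set L) : set L :=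
  [set pcompl (pcompl s) | s in S].

End FrameProperties.

(* Main.v *)
Require Import Defs.
From mathcomp Require Import all_boot all_order all_algebra.
From mathcomp Require Import boolp classical_sets functions cardinality.

Set Implicit Arguments.
Unset Strict Implicit.
Unset Printing Implicit Defensive.

Import Order.TTheory.
Local Open Scope classical_set_scope.
Local Open Scope order_scope.

(** Each condition is compared with basic disconnectedness of [L], by two ideas.

    First, in a zero-dimensional frame the pseudocomplement of [a] is the join
    of the complemented [c] disjoint from [a], and [c] is disjoint from [a]
    exactly when [a] lies below the complement of [c]. Hence [a^*] depends only
    on the complemented elements above [a]: if these have a least element [s],
    then [a^*] is the complement of [s] and [a^*] is complemented
    ([BD_of_CL_reflection]). Conversely, if [a^**] is complemented, it is that
    least element. So basic disconnectedness says that each cozero element has a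
    least complemented element above it, which is (5). By strong
    zero-dimensionality the cozero elements are the countable joins of
    complemented elements, so this is also the existence of countable joins in
    [CL L], which is (4). The distributive law in (2) holds in every Boolean
    algebra. For (3), each existing join in a Boolean algebra is admissible; so
    when [CL L] is sigma-complete, the principal D-ideals are closed under
    countable joins and exhaust [D_sigma L].

    Secondly, [I |-> Sup I] maps each of the ideal frames [lambda L] and
    [beta L] to [L] by a dense frame morphism along which complemented elements
    lift, a complemented [c] lifting to the ideal of all elements below it. Any
    such morphism [h] into a zero-dimensional frame commutes with
    pseudocomplements ([fmor_pcompl]). It preserves cozero elements, and each
    countable join of complemented elements of [L] lifts to one in its domain;
    thus basic disconnectedness passes in both directions, which gives (6) and
    (7) without determining the cozero elements of [lambda L] and [beta L]. *)

(** * Pseudocomplements and joins in a frame *)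

Section FrameBasics.
Context {d : Order.disp_t} {L : frameType d}.
Implicit Types (a b c s x y z : L) (S U : set L).

Lemma Sup_leP S y : Sup S <= y <-> forall x, S x -> x <= y.
Proof.
split=> [Sy x Sx|]; last exact: Sup_le.
by apply: le_trans Sy; exact: Sup_ub.
Qed.

Lemma join_Sup x y : x `|` y = Sup [set x; y].
Proof.
apply/le_anti/andP; split; last first.
  by apply: Sup_le => _ [->|->]; [exact: leUl|exact: leUr].
by rewrite leUx !Sup_ub //; [right|left].
Qed.

Lemma bot_Sup : \bot = Sup set0 :> L.
Proof. by apply/le_anti; rewrite le0x; apply: Sup_le. Qed.

Lemma le_pcompl2 x : x <= pcompl (pcompl x).
Proof. by rewrite le_pcompl pcompl_meet. Qed.

Lemma pcompl3 x : pcompl (pcompl (pcompl x)) = pcompl x.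
Proof.
by apply/le_anti/andP; split; [apply/pcompl_anti|]; exact: le_pcompl2.
Qed.

Lemma pcomplE a b : a `&` b = \bot -> a `|` b = \top -> pcompl a = b.
Proof.
move=> ab0 ab1; apply/le_anti/andP; split; last first.
  by rewrite le_pcompl meetC ab0.
rewrite -[leLHS]meetx1 -ab1 meetUr [pcompl a `&` a]meetC pcompl_meet join0x.
exact: leIr.
Qed.

Lemma CL_compl c : CL L c -> CL L (pcompl c).
Proof.
by move=> cC; exists c; rewrite meetC joinC pcompl_meet CL_pcompl.
Qed.

Lemma CL_pcompl2 c : CL L c -> pcompl (pcompl c) = c.
Proof.
by move=> cC; apply: pcomplE; rewrite 1?meetC 1?joinC ?pcompl_meet ?CL_pcompl.
Qed.

Lemma CL_of_BD a : pcompl a `|` pcompl (pcompl a) = \top ->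
  CL L (pcompl (pcompl a)).
Proof.
by move=> a1; exists (pcompl a); rewrite meetC joinC pcompl_meet.
Qed.

Lemma pcompl2_le a c : CL L c -> (pcompl (pcompl a) <= c) = (a <= c).
Proof.
move=> cC; apply/idP/idP => [|ac]; first exact/le_trans/le_pcompl2.
by rewrite -(CL_pcompl2 cC); do 2!apply: pcompl_anti.
Qed.

Lemma CL_valP c : CL L c <-> exists a : CLtype L, val a = c.
Proof.
split=> [cC|[a <-]]; last by have := valP a; rewrite inE.
by exists (Sub c (mem_set cC)); rewrite SubK.
Qed.

End FrameBasics.

(** * Zero-dimensional frames *)

Section ZeroDimensional.
Context {d : Order.disp_t} {L : frameType d}.
Hypothesis zdL : zero_dimensional L.

Lemma zero_dimensional_le (x y : L) :
  (forall c, CL L c -> c <= x -> c <= y) -> x <= y.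
Proof.
have [S SC ->] := zdL x => h; apply: Sup_le => c Sc.
by apply: h; [exact: SC|exact: Sup_ub].
Qed.

(** For complemented [c], [c <= a^*] means [a <= c^*], so [a] and its least
    complemented upper bound [s] have the same pseudocomplement. *)
Lemma BD_of_CL_reflection (a s : L) : CL L s ->
  (forall c, CL L c -> (s <= c) = (a <= c)) ->
  pcompl a `|` pcompl (pcompl a) = \top.
Proof.
move=> sC sP; suff -> : pcompl a = pcompl s by exact/CL_pcompl/CL_compl.
apply/le_anti/andP; split; last by apply: pcompl_anti; rewrite -sP.
apply: zero_dimensional_le => c cC; rewrite !le_pcompl.
by rewrite ![c `&` _]meetC -[in c in _ `&` c](CL_pcompl2 cC) -!le_pcompl
  !CL_pcompl2 ?sP //; exact: CL_compl.
Qed.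

End ZeroDimensional.

(** The join of [U] formed in [L] need not be complemented, but it has the same
    complemented upper bounds as [U]. *)
Lemma val_isLub d (L : frameType d) (U : set (CLtype L)) (s : CLtype L) :
  isLub U s <->
  forall c : CLtype L, (s <= c) <-> (Sup [set val x | x in U] <= val c).
Proof.
have UP (c : CLtype L) : Sup [set val x | x in U] <= val c <-> ubound U c.
  rewrite Sup_leP; split=> [h x Ux|h _ [x Ux <-]]; first by apply: h; exists x.
  by rewrite CL_val_le; exact: h.
split=> [[sU sl] c|sP]; last first.
  split=> [|c /UP/sP//]; exact/UP/sP.
rewrite UP; split=> [sc x Ux|/sl//]; exact: le_trans (sU _ Ux) sc.
Qed.

(** If [b] bounds every [a `&` x], then [b `|` ~` a] bounds every [x]. *)
Lemma boolean_meet_isLub d (B : ctbDistrLatticeType d) (U : set B) (a s : B) :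
  isLub U s -> isLub [set a `&` x | x in U] (a `&` s).
Proof.
move=> [sU sl]; split=> [_ [x Ux <-]|b bU]; first by apply: leI2 (sU _ Ux).
have : s <= b `|` ~` a.
  apply: sl => x Ux; rewrite -[x]meetx1 -(Order.CTBDistrLatticeTheory.joinxC a).
  rewrite meetUr leUx (le_trans (leIr _ _) (leUr _ _)) andbT.
  by apply: le_trans (leUl _ _); rewrite meetC; apply: bU; exists x.
move=> /(leI2 (lexx a)) /le_trans; apply.
by rewrite meetUr Order.CTBDistrLatticeTheory.meetxC joinx0 leIr.
Qed.

(** * Sigma-completeness of the Boolean algebra of complemented elements *)

Section BasicallyDisconnected.
Context {d : Order.disp_t} {L : frameType d}.

Lemma countable_CL_Coz (U : set (CLtype L)) :
  countable U -> Coz L (Sup [set val x | x in U]).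
Proof.
move=> Uc; apply: Coz_Sup; first exact: sub_countable (card_image_le _ _) _.
by move=> _ [x _ <-]; have := CL_in_Coz x; rewrite inE.
Qed.

(** Double negation reflects cozero elements onto complemented ones: as
    [c = c^**] for complemented [c], [a^** <= c] holds exactly when [a <= c]. *)
Lemma BD_left_adjoint :
  basically_disconnected L -> has_left_adjoint (@CL_to_Coz d L).
Proof.
move=> bdL.
have /choice[g gE] (q : Coztype L) :
    exists c : CLtype L, val c = pcompl (pcompl (val q)).
  by apply/CL_valP/CL_of_BD/bdL; have := valP q; rewrite inE.
exists g => q p; rewrite -CL_val_le -Coz_val_le gE pcompl2_le //.
by apply/CL_valP; exists p.
Qed.

(** A left adjoint sends the join of a countable [U], formed in [Coz L], to the
    join of [U] in [CL L]. *)
Lemma left_adjoint_sigma_complete :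
  has_left_adjoint (@CL_to_Coz d L) ->
  sigma_complete_boolean_algebra (CLtype L).
Proof.
move=> [g gP] U Uc.
have [q qE] : exists q : Coztype L, val q = Sup [set val x | x in U].
  have qC := mem_set (countable_CL_Coz Uc).
  by exists (Sub (Sup [set val x | x in U]) qC); rewrite SubK.
by exists (g q); apply/val_isLub => c; rewrite gP -Coz_val_le qE SubK.
Qed.

(** Strong zero-dimensionality writes a cozero [a] as the join in [L] of a
    countable [S] of complemented elements; the join of [S] in [CL L] is then
    the least complemented element above [a]. *)
Lemma sigma_complete_BD : strongly_zero_dimensional L ->
  sigma_complete_boolean_algebra (CLtype L) -> basically_disconnected L.
Proof.
move=> [zdL szL] cB a /szL[S [Sc SC ->]].
pose U : set (CLtype L) := [set x | S (val x)].
have USE : [set val x | x in U] = S.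
  apply/seteqP; split=> [_ [x Sx <-]//|x Sx].
  have /CL_valP[y yx] := SC x Sx.
  by exists y => //; rewrite /U /= yx.
have Uc : countable U.
  move: Sc => /countable_injP[f finj]; apply/countable_injP; exists (f \o val).
  move=> x y; rewrite !inE => Sx Sy /finj xy; apply: val_inj.
  by apply: xy; rewrite inE.
have [s /val_isLub sP] := cB U Uc; rewrite USE in sP.
apply: (@BD_of_CL_reflection _ _ zdL _ (val s)) => [|c /CL_valP[c' <-]].
  by apply/CL_valP; exists s.
by rewrite CL_val_le; apply/idP/idP => /sP.
Qed.

Lemma CL_basicE : CL_basic L <-> sigma_complete_boolean_algebra (CLtype L).
Proof.
split=> [[]//|cB]; split=> // U s a _; exact: boolean_meet_isLub.
Qed.

End BasicallyDisconnected.

(** * Principal D-ideals of complemented elements *)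

Section DSigma.
Context {d : Order.disp_t} {L : frameType d}.

Fact CL_below_D_ideal (a : CLtype L) :
  CL_below (val a) \in D_ideal (CLtype L).
Proof.
rewrite inE; split=> [b c bc ca|G g _ Ga [_ gl]].
  by apply: le_trans ca; rewrite CL_val_le.
rewrite /CL_below /= CL_val_le; apply: gl => b /Ga.
by rewrite /CL_below /= CL_val_le.
Qed.

Definition principal (a : CLtype L) : D_infty (CLtype L) :=
  Sub (CL_below (val a)) (CL_below_D_ideal a).

Lemma principal_le a (E : D_infty (CLtype L)) : principal a <= E <-> val E a.
Proof.
rewrite ideal_frame_le SubK; split=> [|Ea b ba]; first by apply; exact: lexx.
have := valP E; rewrite inE => -[dE _]; exact: dE ba Ea.
Qed.

Lemma principal_mono (a b : CLtype L) : (principal a <= principal b) = (a <= b).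
Proof.
by apply/idP/idP => [/principal_le|ab]; [|apply/principal_le];
  rewrite SubK /CL_below /= CL_val_le.
Qed.

Lemma boolean_admissible (U : set (CLtype L)) s : isLub U s -> admissible U.
Proof. by move=> Us; exists s; split=> // a; exact: boolean_meet_isLub. Qed.

(** A D-ideal containing every member of a countable [V] contains the join of
    [V] in [CL L], because [V] is admissible; so the join of the corresponding
    principal D-ideals is again principal. *)
Lemma principal_sub_sigma_frame :
  sigma_complete_boolean_algebra (CLtype L) ->
  sub_sigma_frame (range principal).
Proof.
move=> cB; split.
- exists \top => //; apply/le_anti; rewrite lex1 ideal_frame_le SubK.
  by move=> x _; exact: lex1.
- move=> _ _ [a _ <-] [b _ <-]; exists (a `&` b) => //; apply/le_anti.
  rewrite lexI !principal_mono leIl leIr ideal_frame_le /= => x [xa xb].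
  by rewrite /CL_below /= lexI; apply/andP.
move=> U Uc UP; pose V : set (CLtype L) := [set a | U (principal a)].
have Vc : countable V.
  move: Uc => /countable_injP[f finj]; apply/countable_injP.
  exists (f \o principal) => x y; rewrite !inE => Ux Uy /finj xy.
  have {}xy : principal x = principal y by apply: xy; rewrite inE.
  by apply/le_anti; rewrite -!principal_mono xy lexx.
have [s sV] := cB V Vc; exists s => //; apply/le_anti/andP; split; last first.
  apply: Sup_le => E UE; have [a _ aE] := UP _ UE; rewrite -aE principal_mono.
  by apply: sV.1; rewrite /V /= aE.
apply/principal_le; have := valP (Sup U); rewrite inE => -[_].
apply; [exact: boolean_admissible sV| |exact: sV].
by move=> a Va; apply/principal_le/Sup_ub.
Qed.

Lemma D_sigma_principal : sigma_complete_boolean_algebra (CLtype L) ->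
  D_sigma L = range principal.
Proof.
have gen : [set E : D_infty (CLtype L) |
    exists a : CLtype L, val E = CL_below (val a)] = range principal.
  apply/seteqP; split=> [E [a Ea]|_ [a _ <-]]; last by exists a; rewrite SubK.
  by exists a => //; apply: val_inj; rewrite SubK.
move=> cB; rewrite /D_sigma gen; apply/seteqP; split.
  by apply: smallest_sub => //; exact: principal_sub_sigma_frame.
exact: sub_gen_smallest.
Qed.

Lemma CL_below_inj : zero_dimensional L -> injective (@CL_below d L).
Proof.
move=> zdL; suff le (x y : L) : CL_below x = CL_below y -> x <= y.
  by move=> x y xy; apply/le_anti/andP; split; exact: le.
move=> xy; apply: (zero_dimensional_le zdL) => _ /CL_valP[c <-] cx.
by have : CL_below x c by []; rewrite xy.
Qed.

Lemma D_sigma_CL_eq : zero_dimensional L ->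
  sigma_complete_boolean_algebra (CLtype L) -> D_sigma_CL L = CL L.
Proof.
move=> zdL cB; apply/seteqP; split=> x.
  move=> [E]; rewrite D_sigma_principal // => -[a _ <-].
  by rewrite SubK => /(CL_below_inj zdL) <-; apply/CL_valP; exists a.
move=> /CL_valP[a <-]; exists (principal a); last by rewrite SubK.
by rewrite D_sigma_principal //; exists a.
Qed.

Lemma skeleton_Coz : skeleton_image (Coz L) = CL L <-> basically_disconnected L.
Proof.
split=> [sE a aC|bdL].
  have : CL L (pcompl (pcompl a)) by rewrite -sE; exists a.
  by move=> /CL_pcompl; rewrite pcompl3 joinC.
apply/seteqP; split=> [_ [a aC <-]|c cC]; first exact/CL_of_BD/bdL.
by exists c; [exact: CL_subset_Coz|exact: CL_pcompl2].
Qed.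

End DSigma.

(** * Dense frame morphisms *)

Record dense_frame_morphism d d' (M : frameType d) (L : frameType d')
    (h : M -> L) : Prop := {
  fmor_top : h \top = \top;
  fmor_meet : forall x y, h (x `&` y) = h x `&` h y;
  fmor_Sup : forall S, h (Sup S) = Sup [set h x | x in S];
  fmor_dense : forall x, h x = \bot -> x = \bot }.

Section DenseMorphism.
Context {d d' : Order.disp_t} {M : frameType d} {L : frameType d'}.
Variable h : M -> L.
Hypothesis hP : dense_frame_morphism h.

Lemma fmor_bot : h \bot = \bot.
Proof. by rewrite bot_Sup (fmor_Sup hP) image_set0 -bot_Sup. Qed.

Lemma fmor_join x y : h (x `|` y) = h x `|` h y.
Proof. by rewrite !join_Sup (fmor_Sup hP) image_setU !image_set1. Qed.

Lemma fmor_pcompl_le x : h (pcompl x) <= pcompl (h x).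
Proof.
by rewrite le_pcompl -(fmor_meet hP) meetC pcompl_meet fmor_bot.
Qed.

Lemma fmor_completely_below x y : x ≺≺ y -> h x ≺≺ h y.
Proof.
move=> [c [<- <- cP]]; exists (h \o c); split=> // p q p0 pq q1.
apply/le_anti; rewrite lex1 /= -(fmor_top hP) -(cP p q p0 pq q1) fmor_join.
by apply: leU2 => //; exact: fmor_pcompl_le.
Qed.

Lemma fmor_Coz x : Coz M x -> Coz L (h x).
Proof.
move=> [u [uP ->]]; exists (h \o u); split=> [n|].
  exact: fmor_completely_below.
by rewrite (fmor_Sup hP) image_comp.
Qed.

Hypothesis liftCL : forall c, CL L c -> exists2 e, CL M e & h e = c.
Hypothesis zdL : zero_dimensional L.

(** A complemented [h e] disjoint from [h x] forces [e] to be disjoint from [x]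
    by density, and such [h e] have join [pcompl (h x)]. *)
Lemma fmor_pcompl x : h (pcompl x) = pcompl (h x).
Proof.
apply/le_anti; rewrite fmor_pcompl_le /=.
apply: (zero_dimensional_le zdL) => _ /liftCL[e eC <-].
rewrite le_pcompl -(fmor_meet hP) => /eqP /(fmor_dense hP) ex0.
have : e <= pcompl x by rewrite le_pcompl ex0.
by rewrite leEmeet => /eqP <-; rewrite (fmor_meet hP) leIr.
Qed.

(** Here [a^*] and [a^**], for [a = h x], are complements of each other; they
    lift to complements [e] and [f], which density puts below [x^*] and
    [x^**]. *)
Lemma dense_BD_domain : basically_disconnected L -> basically_disconnected M.
Proof.
move=> bdL x xC; have aC := fmor_Coz xC; set a := h x in aC.
have [e [f [ef0 ef1]] ea] : exists2 e, CL M e & h e = pcompl a.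
  by apply: liftCL; rewrite -pcompl3; exact/CL_compl/CL_of_BD/bdL.
have fE : h f = pcompl (pcompl a).
  by apply/esym/pcomplE; rewrite -ea -?(fmor_meet hP) -?fmor_join
    ?ef0 ?ef1 ?fmor_bot ?(fmor_top hP).
apply/le_anti; rewrite lex1 /= -ef1; apply: leU2; rewrite le_pcompl; apply/eqP;
  apply: (fmor_dense hP); rewrite (fmor_meet hP).
  by rewrite ea meetC pcompl_meet.
by rewrite fmor_pcompl fE meetC pcompl_meet.
Qed.

(** A countable join of complemented elements lifts to a join of the same kind,
    hence to a cozero element; [h] carries its disconnection over to [L]. *)
Lemma dense_BD_codomain :
  (forall a : L, Coz L a ->
    exists S : set L, [/\ countable S, S `<=` CL L & a = Sup S]) ->
  basically_disconnected M -> basically_disconnected L.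
Proof.
move=> szL bdM a /szL[S [Sc SC ->]].
(* [\bot] is a default value outside [CL L]. *)
have /choice[g gP] (c : L) : exists e, CL L c -> CL M e /\ h e = c.
  have [cC|] := pselect (CL L c); last by exists \bot.
  by have [e] := liftCL cC; exists e.
have -> : Sup S = h (Sup [set g c | c in S]).
  rewrite (fmor_Sup hP) image_comp; congr Sup.
  apply/seteqP; split=> [c Sc'|_ [c Sc' <-]] /=.
    by exists c => //=; have [] := gP _ (SC _ Sc').
  by have [_ ->] := gP _ (SC _ Sc').
rewrite -!fmor_pcompl -fmor_join bdM ?(fmor_top hP) //.
apply: Coz_Sup; first exact: sub_countable (card_image_le _ _) _.
by move=> _ [c Sc' <-]; apply: CL_subset_Coz; have [] := gP _ (SC _ Sc').
Qed.

End DenseMorphism.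

(** * The frame morphism from a frame of ideals *)

(** [P] is a meet-subsemilattice of [L], included by [v], and [C] and [C'] are
    families of ideals of [P] as in [ideal_system]. The cases in view are
    [P = Coz L] with sigma-ideals, for [lambda L], and [P = L] with regular
    ideals inside all lattice ideals, for [beta L]. *)
Section IdealSup.
Context {d d' : Order.disp_t} {L : frameType d} {P : meetSemilatticeType d'}.
Context {C' C : set (set P)} (sysC : ideal_system C' C).
Local Notation T := (ideal_frame sysC).
Variable v : P -> L.
Hypothesis v_inj : injective v.
Hypothesis vI : forall p q, v (p `&` q) = v p `&` v q.
Hypothesis C_nonempty : forall I, C I -> I !=set0.
Hypothesis C'_below : forall w : L, C' [set p | v p <= w].
Hypothesis C_CL : forall c, CL L c -> C [set p | v p <= c].
Hypothesis v_CL : forall c, CL L c -> exists p, v p = c.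

Definition ideal_Sup (I : T) : L := Sup [set v p | p in val I].

Definition ideal_of_CL c (cC : CL L c) : T :=
  Sub [set p | v p <= c] (mem_set (C_CL cC)).

Lemma ideal_SupE c (cC : CL L c) : ideal_Sup (ideal_of_CL cC) = c.
Proof.
apply/le_anti/andP; split; first by apply: Sup_le => _ [p + <-]; rewrite SubK.
have [p pc] := v_CL cC.
by apply: Sup_ub; exists p => //; rewrite SubK /= pc.
Qed.

(** Joins are preserved because the elements of [P] below a given [w] form a
    member of [C'], so that passing from a union of ideals to the ideal that it
    generates does not change the supremum in [L]. *)
Lemma ideal_Sup_morphism : dense_frame_morphism ideal_Sup.
Proof.
have mono I J : I <= J -> ideal_Sup I <= ideal_Sup J.
  rewrite ideal_frame_le => IJ; apply: Sup_le => _ [p Ip <-].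
  by apply: Sup_ub; exists p => //; exact: IJ.
have down (I : T) p q : v p <= v q -> val I q -> val I p.
  rewrite leEmeet -vI => /eqP/v_inj pq; have := valP I; rewrite inE.
  by move=> /(sys_down sysC); apply; rewrite leEmeet pq.
split.
- apply/le_anti; rewrite lex1 /= -[leLHS](ideal_SupE CL1); exact/mono/lex1.
- move=> I J; apply/le_anti/andP; split; first by rewrite lexI !mono ?leIl ?leIr.
  rewrite meet_Sup; apply: Sup_le => _ [_ [q Jq <-] <-].
  rewrite meetC meet_Sup; apply: Sup_le => _ [_ [p Ip <-] <-].
  apply: Sup_ub; exists (q `&` p); rewrite ?vI //; split.
    by apply: down Ip; rewrite vI leIr.
  by apply: down Jq; rewrite vI leIl.
- move=> S; apply/le_anti/andP; split; last first.
    by apply: Sup_le => _ [I SI <-]; exact/mono/Sup_ub.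
  apply: Sup_le => _ [p Sp <-]; move: p Sp; apply: smallest_sub.
    exact: C'_below.
  move=> p [_ [I SI <-] Ip]; apply: (@le_trans _ _ (ideal_Sup I)).
    by apply: Sup_ub; exists p.
  by apply: Sup_ub; exists I.
move=> I I0; apply/le_anti; rewrite le0x andbT ideal_frame_le => p Ip.
have [q bq] : val (\bot : T) !=set0.
  by apply: C_nonempty; have := valP (\bot : T); rewrite inE.
apply: down bq; apply: (@le_trans _ _ \bot); last exact: le0x.
by rewrite -I0; apply: Sup_ub; exists p.
Qed.

Hypothesis C'_join : forall I p q t,
  C' I -> I p -> I q -> v t = v p `|` v q -> I t.

(** The lifts of [c] and of its complement have meet [\bot] by density; their
    join contains the join of [c] and its complement, that is, a top element. *)
Lemma ideal_Sup_liftCL c : CL L c -> exists2 e, CL T e & ideal_Sup e = c.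
Proof.
move=> cC; have c'C := CL_compl cC.
set I := ideal_of_CL cC; set I' := ideal_of_CL c'C.
exists I; last exact: ideal_SupE.
have hP := ideal_Sup_morphism; exists I'; split.
  by apply: (fmor_dense hP); rewrite (fmor_meet hP) !ideal_SupE pcompl_meet.
have [[t t1] [p pc] [p' pc']] := And3 (v_CL CL1) (v_CL cC) (v_CL c'C).
have := valP (I `|` I'); rewrite inE => IC.
have tI : val (I `|` I') t.
  apply: (@C'_join _ p p'); first exact: (sys_sub sysC).
  - have : I <= I `|` I' by exact: leUl.
    by rewrite ideal_frame_le; apply; rewrite SubK /= pc.
  - have : I' <= I `|` I' by exact: leUr.
    by rewrite ideal_frame_le; apply; rewrite SubK /= pc'.
  - by rewrite t1 pc pc' CL_pcompl.
apply/le_anti; rewrite lex1 /= ideal_frame_le => q _.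
apply: (sys_down sysC IC) tI; rewrite leEmeet; apply/eqP/v_inj.
by rewrite vI t1 meetx1.
Qed.

Lemma ideal_frame_BD : strongly_zero_dimensional L ->
  basically_disconnected T <-> basically_disconnected L.
Proof.
move=> [zdL szL]; split.
  exact: (dense_BD_codomain ideal_Sup_morphism ideal_Sup_liftCL zdL szL).
exact: (dense_BD_domain ideal_Sup_morphism ideal_Sup_liftCL zdL).
Qed.

End IdealSup.

Section Coreflections.
Context {d : Order.disp_t} {L : frameType d}.
Hypothesis szL : strongly_zero_dimensional L.

Lemma lambda_BD :
  basically_disconnected (lambda L) <-> basically_disconnected L.
Proof.
have below (w : L) : sigma_ideal (Coztype L) [set p | val p <= w].
  split=> [x y xy|U s Uc Uw /(Coz_isLub _ Uc) sE]; rewrite /=.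
    by apply: le_trans; rewrite Coz_val_le.
  by rewrite sE; apply: Sup_le => _ [x /Uw xw <-].
apply: (@ideal_frame_BD _ _ _ _ _ _ _ val) => //.
- move=> I [_ cI]; exists \bot; apply: (cI set0) => //.
  by split=> // b _; exact: le0x.
- move=> c /CL_subset_Coz cC; have cC' : c \in Coz L by rewrite inE.
  by exists (Sub c cC'); rewrite SubK.
move=> I p q t [_ cI] Ip Iq tE; apply: (cI [set p; q]).
- by apply: finite_set_countable; exact: finite_set2.
- by move=> _ [->|->].
apply/Coz_isLub; first by apply: finite_set_countable; exact: finite_set2.
by rewrite tE join_Sup image_setU !image_set1.
Qed.

Lemma beta_BD : basically_disconnected (beta L) <-> basically_disconnected L.
Proof.
have below (w : L) : lattice_ideal L [set p | p <= w].
  split=> [|x y xy|x y xw yw]; rewrite /=.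
  - by exists w => /=.
  - exact: le_trans.
  - by rewrite leUx; apply/andP.
apply: (@ideal_frame_BD _ _ _ _ _ _ _ id) => //.
- by move=> I [[]].
- move=> c cC; split=> // x xc; exists c => //=.
  exact: completely_belowW xc (CL_completely_below cC) (lexx _).
- by move=> c _; exists c.
by move=> I p q t [_ _ jI] Ip Iq ->; exact: jI.
Qed.

End Coreflections.

Theorem corollary6p17 (d : Order.disp_t) (L : frameType d) :
  strongly_zero_dimensional L ->
  [<-> (*1*) basically_disconnected L;
       (*2*) CL_basic L;
       (*3*) CL L = D_sigma_CL L /\ D_sigma_CL L = skeleton_image (Coz L);
       (*4*) sigma_complete_boolean_algebra (CLtype L);
       (*5*) has_left_adjoint (@CL_to_Coz d L);
       (*6*) basically_disconnected (lambda L);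
       (*7*) basically_disconnected (beta L)].
Proof.
move=> szL; have [zdL _] := szL.
have BD_sigma : basically_disconnected L ->
    sigma_complete_boolean_algebra (CLtype L).
  by move=> /BD_left_adjoint/left_adjoint_sigma_complete.
tfae.
- by move=> /BD_sigma/CL_basicE.
- move=> /CL_basicE cB; rewrite D_sigma_CL_eq //; split=> //.
  exact/esym/skeleton_Coz/sigma_complete_BD.
- by move=> [<- /esym sE]; apply/BD_sigma/skeleton_Coz.
- by move=> /(sigma_complete_BD szL)/BD_left_adjoint.
- by move=> /left_adjoint_sigma_complete/(sigma_complete_BD szL)/(lambda_BD szL).
- by move=> /(lambda_BD szL)/(beta_BD szL).
- by move=> /(beta_BD szL).
Qed.
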